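(* Let $X$ be a nonzero real Banach space. An operator $T:\mathscr{C}(X)\to\mathscr{C}(X)$ is an order preserving involution if and only if there exist $c\in X$, $w\in X^*$ and a continuous automorphism $E$ of $X$ satisfying $E^2=I_X$, $c\in\mathrm{Ker}(E+I_X)$, $w\in\mathrm{Ker}(E^*+I_{X^*})$, such that $$T(f)(x)=f(Ex+c)+\langle w,x\rangle-\tfrac12\langle w,c\rangle$$ for all $f\in\mathscr{C}(X)$ and all $x\in X$.
   Context: $X^*$ is the topological dual of $X$ and $\langle u,x\rangle=u(x)$ for $u\in X^*$, $x\in X$. $\mathscr{C}(X)$ is the set of proper (not identically $+\infty$), convex, (norm) lower semicontinuous functions $f:X\to\mathbb{R}\cup\{+\infty\}$, ordered pointwise. An operator $T:\mathscr{C}(X)\to\mathscr{C}(X)$ is order preserving if $f\le g$ implies $T(f)\le T(g)$; it is an involution if $T(T(f))=f$ for all $f\in\mathscr{C}(X)$; an order preserving involution is an operator that is both. A continuous automorphism of $X$ is a continuous linear bijection $X\to X$; $E^*:X^*\to X^*$ is the adjoint of $E$; $I_X$, $I_{X^*}$ are the identity operators of $X$ and $X^*$. *)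

(* Defs.v *)
From HB Require Import structures.
From mathcomp Require Import all_boot all_order all_algebra.
From mathcomp Require Import all_classical all_reals all_analysis.

Set Implicit Arguments.
Unset Strict Implicit.
Unset Printing Implicit Defensive.

Import Order.TTheory GRing.Theory Num.Theory.
Import numFieldNormedType.Exports.

Local Open Scope classical_set_scope.
Local Open Scope ring_scope.

Section ContinuousLinear.
Context {R : realType}.

Definition continuous_linear (X Y : normedModType R) : {pred X -> Y} :=
  fun f => `[< linear f /\ continuous f >].

Lemma continuous_linear_submod_closed (X Y : normedModType R) :
  submod_closed (@continuous_linear X Y).
Proof.
split=> [|a f g].
  by apply/asboolP; split=> [b x y|]; [rewrite scaler0 addr0|exact: cst_continuous].
move=> /asboolP[lf cf] /asboolP[lg cg]; apply/asboolP; split.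
  move=> b x y; rewrite !fctE lf lg !scalerDr !scalerA [b * a]mulrC.
  by rewrite -!addrA; congr (_ + _); rewrite addrCA.
move=> x; apply: continuousD; last exact: cg.
by apply: continuousZ; [exact: cst_continuous|exact: cf].
Qed.

HB.instance Definition _ (X Y : normedModType R) :=
  GRing.isSubmodClosed.Build R (X -> Y) (@continuous_linear X Y)
    (continuous_linear_submod_closed X Y).

(* The library has no type of continuous linear maps; the subtype inherits the
   pointwise vector space structure of [X -> Y]. *)
Record clinear (X Y : normedModType R) := CLinear {
  clinear_fun :> X -> Y;
  clinearP : clinear_fun \in @continuous_linear X Y }.

HB.instance Definition _ (X Y : normedModType R) :=
  [isSub for @clinear_fun X Y].
HB.instance Definition _ (X Y : normedModType R) :=
  [Choice of clinear X Y by <:].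
HB.instance Definition _ (X Y : normedModType R) :=
  [SubChoice_isSubLmodule of clinear X Y by <:].

Lemma clinear_linear (X Y : normedModType R) (f : clinear X Y) : linear f.
Proof. by case: f => f /= /asboolP[]. Qed.

Lemma clinear_continuous (X Y : normedModType R) (f : clinear X Y) :
  continuous f.
Proof. by case: f => f /= /asboolP[]. Qed.

HB.instance Definition _ (X Y : normedModType R) (f : clinear X Y) :=
  GRing.isLinear.Build R X Y _ (clinear_fun f) (clinear_linear f).

Lemma comp_continuous_linear (X Y Z : normedModType R)
    (g : clinear Y Z) (f : clinear X Y) :
  g \o f \in @continuous_linear X Z.
Proof.
apply/asboolP; split=> [a x y|x] /=.
  by rewrite !clinear_linear.
by apply: continuous_comp; exact: clinear_continuous.
Qed.

Definition clinear_comp (X Y Z : normedModType R)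
    (g : clinear Y Z) (f : clinear X Y) : clinear X Z :=
  CLinear (comp_continuous_linear g f).

Definition dual (X : normedModType R) := clinear X R^o.

(* [R^o] is [R] seen as a module over itself; [pairing] returns to [R]. *)
Definition pairing (X : normedModType R) (u : dual X) (x : X) : R := u x.

Definition adjoint (X Y : normedModType R) (E : clinear X Y) :
  dual Y -> dual X := fun u => clinear_comp u E.

End ContinuousLinear.

Definition ker (V W : zmodType) (f : V -> W) : set V := [set v | f v = 0].

Section ConvexFunctions.
Context {R : realType}.
Local Open Scope ereal_scope.

Definition proper (X : Type) (f : X -> \bar R) :=
  (forall x, f x != -oo) /\ (exists x, f x != +oo).

(* The library's [convex_function] only covers real-valued functions. *)
Definition convex (X : lmodType R) (f : X -> \bar R) :=
  forall (x y : X) (t : R), (0 < t < 1)%R ->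
    f (t *: x + (1 - t) *: y)%R <= t%:E * f x + (1 - t)%:E * f y.

(* Functions with values in ]-oo, +oo]: [proper] also excludes -oo. *)
Record cvxfun (X : normedModType R) := CvxFun {
  cvxfun_fun :> X -> \bar R;
  cvxfun_proper : proper cvxfun_fun;
  cvxfun_convex : convex cvxfun_fun;
  cvxfun_lsc : lower_semicontinuous cvxfun_fun }.

Definition cvxfun_le (X : normedModType R) (f g : cvxfun X) :=
  forall x, f x <= g x.

Definition order_preserving (X : normedModType R)
    (T : cvxfun X -> cvxfun X) := {homo T : f g / cvxfun_le f g}.

Definition order_preserving_involution (X : normedModType R)
    (T : cvxfun X -> cvxfun X) := order_preserving T /\ involutive T.

End ConvexFunctions.

(* Main.v *)
Require Import Defs.
From HB Require Import structures.
From mathcomp Require Import all_boot all_order all_algebra.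
From mathcomp Require Import all_classical all_reals all_analysis.
From mathcomp Require Import ring lra.

(* For [y : X] and [r : R] let [pt y r] be the indicator function of [{y}] plus
   [r]. These are exactly the functions whose majorants form a chain, so [T]
   permutes them: [T (pt y r) = pt (psi y) (rho y r)]. Since [f <= pt y r] means
   [f y <= r], the pair [(psi, rho)] carries the epigraph of [f] to that of
   [T f]. A point majorizes every common minorant of two points iff it lies on
   or above the segment joining them, so [(psi, rho)] maps segments to segments.
   A Pexider equation with monotone solutions then gives
   [rho y r = tau y * r + sigma y]; that segments stay segments forces [tau] to
   be constant, and [T] being an involution forces [tau = 1] and makes [psi] and
   [sigma] affine. Thus [T f x = f (psi x) + h x] with [psi] and [h] affine.
   Finally [h = T 0] is lower semicontinuous, hence continuous, and the Baire
   category theorem applied to [T `|.|] shows that [psi] is continuous. *)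

Import Order.TTheory GRing.Theory Num.Theory.
Import numFieldNormedType.Exports.

Local Open Scope classical_set_scope.
Local Open Scope ring_scope.

(** * Additive functions on the real line and affine maps *)

Section RealFunctions.
Context {R : realType}.

(** If [B x] were nonzero, its multiples [B (x *+ n)] would eventually exceed [M]. *)
Lemma bounded_additive_eq0 (B : R -> R) (M : R) :
  {morph B : x y / x + y} -> (forall x, `|B x| <= M) -> forall x, B x = 0.
Proof.
move=> addB bndB x; apply/eqP; rewrite -normr_eq0; apply/eqP/le_anti.
rewrite normr_ge0 andbT leNgt; apply/negP => Bx_gt0.
have Bn n : B (x *+ n.+1) = B x *+ n.+1.
  by elim: n => [//|n IHn]; rewrite mulrS addB IHn -mulrS.
pose n := Num.truncn (M / `|B x|).
have := bndB (x *+ n.+1); rewrite Bn normrMn leNgt => /negP; apply.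
by rewrite -mulr_natr mulrC -ltr_pdivrMr// truncnS_gt.
Qed.

(** On integers, additivity alone gives [A z = A 1 * z]. The defect [B] is therefore additive and
    depends only on the fractional part of its argument; on [0, 1] monotonicity bounds it by [A 1],
    so it vanishes. *)
Lemma monotone_additive_linear (A : R -> R) :
  {morph A : x y / x + y} -> {homo A : x y / x <= y} ->
  forall x, A x = A 1 * x.
Proof.
move=> addA homoA.
have A0 : A 0 = 0 by have := addA 0 0; rewrite addr0; lra.
have A1 : 0 <= A 1 by rewrite -A0; exact: homoA.
have Az (z : int) : A z%:~R = A 1 * z%:~R.
  have An n : A n%:R = A 1 * n%:R.
    elim: n => [|n IHn]; first by rewrite A0 mulr0.
    by rewrite -natr1 addA IHn; ring.
  case: z => n; first exact: An.
  have := addA n.+1%:R (- n.+1%:R).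
  by rewrite addrN A0 An NegzE mulrNz -pmulrn; lra.
pose B x := A x - A 1 * x.
suff B0 x : B x = 0 by move=> x; have := B0 x; rewrite /B; lra.
apply: (@bounded_additive_eq0 B (A 1)) => [y z|y]; first by rewrite /B addA; ring.
have -> : B y = A (y - (Num.floor y)%:~R) - A 1 * (y - (Num.floor y)%:~R).
  rewrite /B; have := addA (y - (Num.floor y)%:~R) (Num.floor y)%:~R.
  by rewrite subrK Az; lra.
set d := y - _.
have d0 : 0 <= d by rewrite subr_ge0 floor_le.
have d1 : d <= 1 by have := floorD1_gt y; rewrite intrD /d; lra.
have Ad0 : 0 <= A d by rewrite -A0; exact: homoA.
have Ad1 : A d <= A 1 by exact: homoA.
have p0 : 0 <= A 1 * d by exact: mulr_ge0.
have p1 : A 1 * d <= A 1 by rewrite ler_piMr.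
by rewrite ler_norml; apply/andP; split; lra.
Qed.

End RealFunctions.

(** Combinations with the origin give homogeneity for factors in ]0, 1[, midpoints then give
    additivity, and inverses and signs reach all other factors. *)
Lemma convex_combination_affine {R : realType} {X V : lmodType R} (g : X -> V) :
  (forall x y (t : R), 0 < t < 1 ->
    g (t *: x + (1 - t) *: y) = t *: g x + (1 - t) *: g y) ->
  linear (fun x => g x - g 0).
Proof.
move=> gE; set L := fun x => g x - g 0.
have LE x y (t : R) : 0 < t < 1 ->
    L (t *: x + (1 - t) *: y) = t *: L x + (1 - t) *: L y.
  move=> t01; rewrite /L gE// !scalerBr addrACA; congr (_ + _).
  by rewrite -opprD -scalerDl addrC subrK scale1r.
have L0 : L 0 = 0 by rewrite /L subrr.
have LZ1 x (t : R) : 0 < t < 1 -> L (t *: x) = t *: L x.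
  by move=> t01; have := LE x 0 t t01; rewrite L0 !scaler0 !addr0.
have half01 : 0 < (2^-1 : R) < 1 by lra.
have LD x y : L (x + y) = L x + L y.
  have := LE x y 2^-1 half01.
  have -> : 1 - 2^-1 = 2^-1 :> R by lra.
  rewrite -!scalerDr LZ1//; apply: scalerI.
  by rewrite invr_eq0 pnatr_eq0.
have LN x : L (- x) = - L x.
  by apply/eqP; rewrite -addr_eq0 -LD addNr L0.
have LZp x (t : R) : 0 < t -> L (t *: x) = t *: L x.
  move=> t0; have [t1|t1|->] := ltgtP t 1; last by rewrite !scale1r.
    by rewrite LZ1// t0 t1.
  have ti : 0 < t^-1 < 1 by rewrite invr_gt0 t0/= invf_lt1.
  have tn : t != 0 by rewrite gt_eqF.
  by rewrite -[in RHS](scalerK tn x) (LZ1 (t *: x) _ ti) scalerA mulfV// scale1r.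
move=> a x y; rewrite LD; congr (_ + _).
have [a0|a0|->] := ltgtP a 0; last by rewrite !scale0r.
  by rewrite -[a *: x]opprK -scaleNr LN LZp ?oppr_gt0// scaleNr opprK.
exact: LZp.
Qed.

(** * Point functions and segments described by the order of convex functions *)

Section CvxFun.
Context {R : realType} {X : normedModType R}.
Implicit Types (f g h : cvxfun X) (x y z : X) (r s t : R).

Lemma cvxfun_eq f g : (forall x, f x = g x) -> f = g.
Proof.
case: f g => [f pf cf lf] [g pg cg lg] /= /funext fg.
by case: g / fg pg cg lg => *; congr CvxFun; exact: Prop_irrelevance.
Qed.

Lemma cvxfun_le_refl f : cvxfun_le f f.
Proof. by move=> x. Qed.

Lemma cvxfun_le_anti f g : cvxfun_le f g -> cvxfun_le g f -> f = g.
Proof. by move=> fg gf; apply: cvxfun_eq => x; apply/le_anti; rewrite fg gf. Qed.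

Lemma cvxfun_domain f : exists x r, f x = r%:E.
Proof.
have [fNy [x fx]] := cvxfun_proper f.
by exists x; case: (f x) fx (fNy x) => [r _ _|//|//]; exists r.
Qed.

Lemma cvxfun_segment f x y t a b : 0 <= t <= 1 ->
  (f x <= a%:E)%E -> (f y <= b%:E)%E ->
  (f (t *: x + (1 - t) *: y)%R <= (t * a + (1 - t) * b)%R%:E)%E.
Proof.
move=> /andP[]; rewrite le_eqVlt => /predU1P[<- _ _ fy|t0].
  by rewrite scale0r add0r subr0 scale1r mul0r add0r mul1r.
rewrite le_eqVlt => /predU1P[-> fx _|t1 fx fy].
  by rewrite subrr scale0r addr0 scale1r mul0r addr0 mul1r.
have t01 : 0 < t < 1 by rewrite t0 t1.
apply: le_trans (cvxfun_convex f x y t01) _.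
by rewrite [in leRHS]EFinD !EFinM leeD// lee_pmul2l// lte_fin subr_gt0.
Qed.

(** Source of the test functions used below: [k] on [S], extended by [+oo]. Lower semicontinuity
    holds because each strict superlevel set is the union of the complement of [S] and an open
    superlevel set of [k]. *)
Lemma cvxfun_on_closed (S : set X) (k : X -> R) :
  closed S -> S !=set0 -> continuous k ->
  (forall x y t, S x -> S y -> 0 < t < 1 ->
    S (t *: x + (1 - t) *: y) /\
    k (t *: x + (1 - t) *: y) <= t * k x + (1 - t) * k y) ->
  {g : cvxfun X | forall x, g x = if x \in S then (k x)%:E else +oo%E}.
Proof.
move=> cS S0 ck cvx; set g := fun x => if x \in S then (k x)%:E else +oo%E.
have gp : Defs.proper g.
  split=> [x|]; first by rewrite /g; case: ifP.
  by have [x Sx] := S0; exists x; rewrite /g mem_set.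
have gc : Defs.convex g.
  move=> x y t t01; rewrite /g.
  have [t0 t1] : 0 < t /\ 0 < 1 - t by move: t01 => /andP[]; lra.
  case: (ifPn (x \in S)) => [/set_mem Sx|_]; last first.
    rewrite gt0_muley ?lte_fin// addye ?leey//.
    by case: ifP => _; rewrite -?EFinM// gt0_muley ?lte_fin.
  case: (ifPn (y \in S)) => [/set_mem Sy|_]; last first.
    by rewrite (@gt0_muley _ (1 - t)%:E) ?lte_fin// addey ?leey// -EFinM.
  have [Sz kz] := cvx x y t Sx Sy t01.
  by rewrite mem_set// -!EFinM -EFinD lee_fin.
have gl : lower_semicontinuous g.
  have ok a : open [set x | a < k x].
    apply: (@open_comp _ _ k [set z | a < z]); last exact: open_gt.
    by move=> x _; exact: ck.
  apply/lower_semicontinuousP => a.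
  have -> : [set x | (a%:E < g x)%E] = ~` S `|` [set x | a < k x].
    apply/seteqP; split=> x /=; rewrite /g.
      case: ifPn => [/set_mem Sx|/negP Sx _]; first by rewrite lte_fin; right.
      by left=> /mem_set.
    case: ifPn => [/set_mem Sx [//|]|_ _]; first by rewrite lte_fin.
    by rewrite ltry.
  by apply: openU => //; exact: closed_openC.
by exists (CvxFun gp gc gl).
Qed.

Lemma cvxfun_of_real (k : X -> R) : continuous k ->
  (forall x y t, 0 < t < 1 ->
    k (t *: x + (1 - t) *: y) <= t * k x + (1 - t) * k y) ->
  {g : cvxfun X | forall x, g x = (k x)%:E}.
Proof.
move=> ck cvx.
have [|x y t _ _ t01|g gE] := cvxfun_on_closed setT k closedT _ ck.
- by exists 0.
- by split=> //; exact: cvx.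
by exists g => x; rewrite gE in_setT.
Qed.

Let pt_spec y r :
  {g : cvxfun X | forall x, g x = if x \in [set y] then r%:E else +oo%E}.
Proof.
apply: cvxfun_on_closed.
- apply: accessible_closed_set1; apply: hausdorff_accessible.
  exact: norm_hausdorff.
- by exists y.
- exact: cst_continuous.
- move=> _ _ t /= -> -> _; rewrite -scalerDl -mulrDl addrC subrK scale1r mul1r.
  by split.
Qed.

Definition pt y r : cvxfun X := sval (pt_spec y r).

Lemma ptE y r x : pt y r x = if x == y then r%:E else +oo%E.
Proof.
rewrite /pt; case: (pt_spec y r) => g /= ->.
have [->|/eqP xy] := eqVneq x y; first by rewrite mem_set.
by case: ifPn => // /set_mem.
Qed.

Lemma le_pt f y r : cvxfun_le f (pt y r) <-> (f y <= r%:E)%E.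
Proof.
split=> [/(_ y)|fy x]; first by rewrite ptE eqxx.
by rewrite ptE; case: eqVneq => [->//|_]; rewrite leey.
Qed.

Lemma pt_le y r z s : cvxfun_le (pt y r) (pt z s) <-> y = z /\ r <= s.
Proof.
rewrite le_pt ptE; case: eqVneq => [->|zy]; first by rewrite lee_fin; split=> [|[]].
by split=> [|[yz]]; rewrite ?leye_eq// yz eqxx in zy *.
Qed.

(** Stated by the order alone, hence invariant under every order isomorphism. *)
Definition comparable_above f :=
  forall g h, cvxfun_le f g -> cvxfun_le f h -> cvxfun_le g h \/ cvxfun_le h g.

(** A function finite at two distinct points lies below a point function at each of them, and these
    two are incomparable. Conversely, majorants of [pt y r] are [+oo] off [y], so their values at
    [y] order them. *)
Lemma comparable_above_pt f : comparable_above f <-> exists y r, f = pt y r.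
Proof.
split=> [fC|[y [r ->]] g h yg yh].
  have [y [r fy]] := cvxfun_domain f; exists y, r.
  have fyr : cvxfun_le f (pt y r) by apply/le_pt; rewrite fy.
  apply: cvxfun_le_anti => // x; rewrite ptE; case: eqVneq => [->|xy].
    by rewrite fy.
  rewrite leye_eq; case: (cvxfun_proper f) => /(_ x) + _.
  case fx: (f x) => [s| |]// _; exfalso.
  have fxs : cvxfun_le f (pt x s) by apply/le_pt; rewrite fx.
  by case: (fC _ _ fyr fxs) => /pt_le[yx]; rewrite yx eqxx in xy.
have [gh|/ltW hg] := leP (g y) (h y); [left|right].
- move=> x; have [->//|xy] := eqVneq x y.
  by have := yh x; rewrite ptE (negbTE xy) leye_eq => /eqP ->; rewrite leey.
- move=> x; have [->//|xy] := eqVneq x y.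
  by have := yg x; rewrite ptE (negbTE xy) leye_eq => /eqP ->; rewrite leey.
Qed.

Definition above_lower_bounds g h f :=
  forall k, cvxfun_le k g -> cvxfun_le k h -> cvxfun_le k f.

(** Points on or above the segment qualify by convexity of [k]. The other direction tests with a
    single common minorant: the affine interpolation on the segment, [+oo] elsewhere. *)
Lemma above_lower_bounds_pt y z x r s a : y != z ->
  above_lower_bounds (pt y r) (pt z s) (pt x a) <->
  exists t, [/\ 0 <= t <= 1, x = t *: y + (1 - t) *: z & t * r + (1 - t) * s <= a].
Proof.
move=> yz; split=> [glb|[t [t01 -> ta] k /le_pt ky /le_pt kz]]; last first.
  apply/le_pt; apply: le_trans (cvxfun_segment k y z t r s t01 ky kz) _.
  by rewrite lee_fin.
have d0 : 0 < `|y - z| by rewrite normr_gt0 subr_eq0.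
(* [T] recovers the parameter of a point of the segment from its distance to [z]. Being continuous
   on all of [X], it yields both the closedness of the segment [S] and the continuity of the
   interpolation. *)
pose T v : R := `|v - z| / `|y - z|.
pose S := [set v | T v <= 1 /\ v = z + T v *: (y - z)].
have TE t : 0 <= t -> T (z + t *: (y - z)) = t.
  by move=> t0; rewrite /T addrC addKr normrZ ger0_norm// mulfK ?gt_eqF.
have T0 v : 0 <= T v by exact: divr_ge0.
have SE t : 0 <= t <= 1 -> S (z + t *: (y - z)).
  by move=> /andP[t0 t1]; rewrite /S /= TE.
have cT : continuous T.
  move=> v; apply: (@cvgM _ _ _ _ (fun v => `|v - z|)); last exact: cvg_cst.
  by apply: cvg_norm; apply: cvgB; [exact: cvg_id|exact: cvg_cst].
have Sc : closed S.
  have -> : S = [set v | T v <= 1] `&` [set v | `|v - (z + T v *: (y - z))| <= 0].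
    apply/seteqP; split=> v /= [Tv vE]; split=> //; first by rewrite -vE subrr normr0.
    by apply/eqP; rewrite -subr_eq0 -normr_le0.
  apply: closedI.
    by apply: (@preimage_closed _ _ T [set v | v <= 1]) => //; exact: closed_le.
  apply: (@preimage_closed _ _ (fun v => `|v - (z + T v *: (y - z))|)
    [set v | v <= 0]); last exact: closed_le.
  move=> v _; apply: cvg_norm; apply: cvgB; first exact: cvg_id.
  by apply: cvgD; [exact: cvg_cst|apply: cvgZr_tmp; exact: cT].
(* The interpolation takes the value [s] at [z], where [T] is 0, and [r] at [y], where [T] is 1. *)
have [||||k kE] := @cvxfun_on_closed S (fun v => s + T v * (r - s)).
- exact: Sc.
- by exists (z + 0 *: (y - z)); apply: SE; rewrite lexx ler01.
- move=> v; apply: cvgD; first exact: cvg_cst.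
  by apply: cvgM; [exact: cT|exact: cvg_cst].
- move=> u v t [Tu uE] [Tv vE] /andP[t0 t1].
  set c := t * T u + (1 - t) * T v.
  have c0 : 0 <= c by rewrite addr_ge0// mulr_ge0// ?subr_ge0 ltW.
  have c1 : c <= 1.
    have : t * T u <= t * 1 by rewrite ler_pM2l.
    have : (1 - t) * T v <= (1 - t) * 1 by rewrite ler_pM2l// subr_gt0.
    by rewrite /c; lra.
  have -> : t *: u + (1 - t) *: v = z + c *: (y - z).
    rewrite {1}uE {1}vE; move: (y - z) => d.
    by rewrite !scalerDr !scalerA addrACA -!scalerDl [t + _]addrC subrK scale1r.
  by split; [apply: SE; rewrite c0 c1|rewrite TE// /c; lra].
have kx : (k x <= a%:E)%E.
  have yE : y = z + 1 *: (y - z) by rewrite scale1r addrC subrK.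
  have zE : z = z + 0 *: (y - z) by rewrite scale0r addr0.
  have Sy : S y by rewrite yE; apply: SE; rewrite lexx ler01.
  have Sz : S z by rewrite zE; apply: SE; rewrite lexx ler01.
  have Ty : T y = 1 by rewrite yE TE ?ler01.
  have Tz : T z = 0 by rewrite /T subrr normr0 mul0r.
  apply/le_pt; apply: glb; apply/le_pt; rewrite kE mem_set// lee_fin.
    by rewrite Ty; lra.
  by rewrite Tz; lra.
move: kx; rewrite kE; case: ifPn => [/set_mem[Tx xE]|_]; last by rewrite leye_eq.
rewrite lee_fin => ka; exists (T x); split; first by rewrite T0 Tx.
- by rewrite {1}xE scalerBr scalerBl scale1r addrCA.
- by lra.
Qed.

End CvxFun.

(** * Maps of points and heights that carry segments to segments *)

Lemma convex_combination_inj {R : realType} {X : lmodType R} {y z : X} {s t : R} :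
  y != z -> s *: y + (1 - s) *: z = t *: y + (1 - t) *: z -> s = t.
Proof.
move=> yz /eqP; rewrite -subr_eq0 opprD addrACA -!scalerBl.
have -> : 1 - s - (1 - t) = - (s - t) by ring.
by rewrite scaleNr -scalerBr scaler_eq0 !subr_eq0 (negbTE yz) orbF => /eqP.
Qed.

Section EpigraphMap.
Context {R : realType} {X : lmodType R}.
Variables (psi : X -> X) (rho : X -> R -> R).
Hypothesis X_nonzero : exists x : X, x != 0.
Hypothesis psiK : involutive psi.
Hypothesis rhoK : forall y r, rho (psi y) (rho y r) = r.
Hypothesis rho_homo : forall y, {homo rho y : r s / r <= s}.
Hypothesis segment_le : forall y z (t r s : R), y != z -> 0 <= t <= 1 ->
  exists t' : R, [/\ 0 <= t' <= 1,
    psi (t *: y + (1 - t) *: z) = t' *: psi y + (1 - t') *: psi z &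
    t' * rho y r + (1 - t') * rho z s
      <= rho (t *: y + (1 - t) *: z) (t * r + (1 - t) * s)].

Let psi_neq y z : y != z -> psi y != psi z.
Proof. by apply: contra_neq => /(can_inj psiK). Qed.

(** The parameter [t'] is determined by [psi] alone, so it serves all heights [r] and [s]. Applying
    [segment_le] to the image points with parameter [t'], then mapping back, gives the reverse
    inequality. *)
Let segment_eq y z (t : R) : y != z -> 0 <= t <= 1 ->
  exists t', psi (t *: y + (1 - t) *: z) = t' *: psi y + (1 - t') *: psi z /\
    forall r s : R, rho (t *: y + (1 - t) *: z) (t * r + (1 - t) * s)
      = t' * rho y r + (1 - t') * rho z s.
Proof.
move=> yz t01; have pyz := psi_neq _ _ yz.
have [t' [t'01 psit' _]] := segment_le y z t 0 0 yz t01.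
exists t'; split=> // r s; apply/le_anti/andP; split; last first.
  have [u [_ psiu]] := segment_le y z t r s yz t01.
  by rewrite (convex_combination_inj pyz (etrans (esym psit') psiu)).
have [u [_]] := segment_le _ _ t' (rho y r) (rho z s) pyz t'01.
rewrite -psit' !psiK !rhoK => /(convex_combination_inj yz) <- le_rho.
rewrite -[leRHS](rhoK (psi (t *: y + (1 - t) *: z))) psiK; exact: rho_homo.
Qed.

(* Along the midpoint of two distinct points [segment_eq] is a Pexider equation
   in the real variables; monotonicity excludes the wild solutions. *)
Let rho_affine y : exists t s, 0 < t /\ forall r, rho y r = t * r + s.
Proof.
have [v v0] := X_nonzero.
have v2 : y + v != y - v.
  rewrite -subr_eq0 opprD opprK addrACA subrr add0r -mulr2n -scaler_nat.
  by rewrite scaler_eq0 pnatr_eq0.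
have half01 : 0 <= (2^-1 : R) <= 1 by lra.
have [u [_]] := segment_eq _ _ 2^-1 v2 half01.
have -> : 1 - 2^-1 = 2^-1 :> R by lra.
have -> : 2^-1 *: (y + v) + 2^-1 *: (y - v) = y.
  rewrite -scalerDr addrACA subrr addr0 -(mulr2n y) -(scaler_nat 2 y) scalerA.
  by rewrite mulVf ?scale1r// pnatr_eq0.
move=> rhoE.
pose A r := rho y r - rho y 0.
have addA : {morph A : r s / r + s}.
  move=> r s; have := rhoE (2 * r) (2 * s); have := rhoE 0 0.
  have := rhoE (2 * r) 0; have := rhoE 0 (2 * s).
  have h (a : R) : 2^-1 * (2 * a) = a by field.
  by rewrite !h !mulr0 !addr0 !add0r /A; lra.
have homoA : {homo A : r s / r <= s}.
  by move=> r s rs; rewrite /A lerD2r; exact: rho_homo.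
have AE := monotone_additive_linear A addA homoA.
exists (A 1), (rho y 0); split=> [|r]; last by rewrite -AE /A subrK.
rewrite lt_neqAle; apply/andP; split; last first.
  by have := homoA _ _ (@ler01 R); rewrite {1}/A subrr.
apply/negP => /eqP A10.
have : rho y 1 = rho y 0 by move: A10; rewrite /A; lra.
by move=> /(congr1 (rho (psi y))); rewrite !rhoK => /eqP; rewrite oner_eq0.
Qed.

Lemma epigraph_map_affine : exists sigma : X -> R,
  (forall y r, rho y r = r + sigma y) /\
  forall y z (t : R), 0 < t < 1 ->
    psi (t *: y + (1 - t) *: z) = t *: psi y + (1 - t) *: psi z /\
    sigma (t *: y + (1 - t) *: z) = t * sigma y + (1 - t) * sigma z.
Proof.
have /choice[tau tauP] := rho_affine.
have /choice[sigma rhoE] : forall y, exists s, 0 < tau y /\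
  forall r, rho y r = tau y * r + s by exact: tauP.
have tau0 y : 0 < tau y by case: (rhoE y).
have {}rhoE y r : rho y r = tau y * r + sigma y by case: (rhoE y).
(* Both sides of [segment_eq] are affine in [r] and [s]; the heights (0, 0), (1, 0) and (0, 1)
   separate their coefficients. *)
have segE y z (t : R) : y != z -> 0 <= t <= 1 ->
  exists t', [/\ psi (t *: y + (1 - t) *: z) = t' *: psi y + (1 - t') *: psi z,
    tau (t *: y + (1 - t) *: z) * t = t' * tau y,
    tau (t *: y + (1 - t) *: z) * (1 - t) = (1 - t') * tau z &
    sigma (t *: y + (1 - t) *: z) = t' * sigma y + (1 - t') * sigma z].
  move=> yz t01; have [t' [psit' rhot']] := segment_eq y z t yz t01.
  exists t'; have := rhot' 0 0; have := rhot' 1 0; have := rhot' 0 1.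
  by rewrite !rhoE; split=> //; lra.
(* If [tau y < tau z], then [z] would be an interior point of a segment from
   [y] to some [p] whose image is the end point [psi y]. *)
have tau_le y z : tau z <= tau y.
  rewrite leNgt; apply/negP => tyz.
  have yz : y != z by apply: contraTneq tyz => ->; rewrite ltxx.
  (* With this ratio, [tau z * t = t' * tau y] forces [t' = 1], and the second coefficient identity
     becomes [tau z * (1 - t) = 0], which is impossible. *)
  pose t := tau y / tau z.
  have t0 : 0 < t by exact: divr_gt0.
  have t1 : t < 1 by rewrite ltr_pdivrMr// mul1r.
  have t1n : 1 - t != 0 by rewrite subr_eq0 eq_sym lt_eqF.
  pose p := (1 - t)^-1 *: (z - t *: y).
  have zE : z = t *: y + (1 - t) *: p by rewrite scalerA mulfV// scale1r addrC subrK.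
  have yp : y != p.
    apply: contraNneq yz => yp; rewrite [X in _ == X]zE -yp -scalerDl.
    by rewrite addrC subrK scale1r.
  have t01 : 0 <= t <= 1 by rewrite !ltW.
  have [t' [_ + + _]] := segE y p t yp t01.
  rewrite -zE {1}/t mulrC divfK ?gt_eqF// -[X in X = _]mul1r => /mulIf <-; last first.
    by rewrite gt_eqF.
  by rewrite subrr mul0r => /eqP; rewrite mulf_eq0 (negbTE t1n) gt_eqF.
have tauE y z : tau y = tau z by apply/le_anti; rewrite !tau_le.
(* Since [tau] is constant, applying the map twice multiplies heights by [tau y ^+ 2], which [rhoK]
   forces to be 1. *)
have tau1 y : tau y = 1.
  have := rhoK y 1; have := rhoK y 0; rewrite !rhoE (tauE (psi y) y) => h0 h1.
  have /eqP : tau y ^+ 2 = 1 by rewrite expr2; lra.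
  by rewrite sqrp_eq1 ?ltW// => /eqP.
exists sigma; split=> [y r|y z t /andP[t0 t1]]; first by rewrite rhoE tau1 mul1r.
have [->|yz] := eqVneq y z.
  by rewrite -!scalerDl addrC subrK !scale1r.
have t01 : 0 <= t <= 1 by rewrite !ltW.
(* With [tau] equal to 1, the first coefficient identity reads [t = t']. *)
by have [t' [-> + _ ->]] := segE y z t yz t01; rewrite !tau1 mul1r mulr1 => <-.
Qed.

End EpigraphMap.

(** * The action of an order preserving involution on epigraphs *)

Section Involution.
Context {R : realType} {X : normedModType R}.
Variable T : cvxfun X -> cvxfun X.
Hypothesis Topi : order_preserving_involution T.

Let leT f g : cvxfun_le (T f) (T g) <-> cvxfun_le f g.
Proof.
case: Topi => homoT TK; split=> [/homoT|]; last exact: homoT.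
by rewrite !TK.
Qed.

Let leTl f g : cvxfun_le (T f) g <-> cvxfun_le f (T g).
Proof. by rewrite -{1}(Topi.2 g) leT. Qed.

Let T_pt y r : exists z s, T (pt y r) = pt z s.
Proof.
have /comparable_above_pt Cpt : exists z s, pt y r = pt z s by exists y, r.
apply/comparable_above_pt => g h /leTl yg /leTl yh.
by have := Cpt _ _ yg yh; rewrite !leT.
Qed.

(** Point functions at the same [y] are comparable, hence so are their images, which therefore sit
    at one common point. Height 0 serves to define [psi]. *)
Lemma involution_pt : exists (psi : X -> X) (rho : X -> R -> R),
  forall y r, T (pt y r) = pt (psi y) (rho y r).
Proof.
have /choice[psi psiP] : forall y, exists z, exists s, T (pt y 0) = pt z s.
  by move=> y; exact: T_pt.
suff TE y r : exists s, T (pt y r) = pt (psi y) s.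
  suff /choice[rho rhoP] : forall y, exists f : R -> R,
    forall r, T (pt y r) = pt (psi y) (f r) by exists psi, rho.
  by move=> y; have /choice[f fP] := TE y; exists f.
have [z [s Ts]] := T_pt y r; have [s0 Ts0] := psiP y.
suff -> : psi y = z by exists s.
have [r0|/ltW r0] := leP 0 r.
  have /leT : cvxfun_le (pt y 0) (pt y r) by apply/pt_le.
  by rewrite Ts Ts0 => /pt_le[].
have /leT : cvxfun_le (pt y r) (pt y 0) by apply/pt_le.
by rewrite Ts Ts0 => /pt_le[].
Qed.

Lemma involution_affine (X_nonzero : exists x : X, x != 0) :
  exists (psi : X -> X) (sigma : X -> R),
  [/\ involutive psi, linear (fun x => psi x - psi 0),
     linear (fun x => sigma x - sigma 0 : R^o) &
     forall f x, T f (psi x) = (f x + (sigma x)%:E)%E].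
Proof.
have [psi [rho Tpt]] := involution_pt; have TK := Topi.2.
have ptK y r : pt (psi (psi y)) (rho (psi y) (rho y r)) = pt y r.
  by rewrite -!Tpt TK.
have pt_inj (y z : X) (r s : R) : pt y r = pt z s -> y = z /\ r = s.
  move=> e; have := cvxfun_le_refl (pt y r); rewrite {1}e => /pt_le[<-].
  have := cvxfun_le_refl (pt y r); rewrite {2}e => /pt_le[_].
  by move=> rs sr; split=> //; apply/le_anti; rewrite rs.
have psiK : involutive psi by move=> y; have /pt_inj[] := ptK y 0.
have rhoK y r : rho (psi y) (rho y r) = r by have /pt_inj[] := ptK y r.
have rho_homo y : {homo rho y : r s / r <= s}.
  move=> r s rs; have /leT : cvxfun_le (pt y r) (pt y s) by apply/pt_le.
  by rewrite !Tpt => /pt_le[].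
have [|sigma [rhoE affE]] :=
    @epigraph_map_affine R X psi rho X_nonzero psiK rhoK rho_homo.
  (* The relation [above_lower_bounds] passes through [T], since every [k] is the image of [T k]. *)
  move=> y z t r s yz t01.
  have pyz : psi y != psi z by apply: contra_neq yz => /(can_inj psiK).
  suff /(above_lower_bounds_pt _ _ _ _ _ _ pyz)[t' [? ? ?]] : above_lower_bounds
      (pt (psi y) (rho y r)) (pt (psi z) (rho z s))
      (pt (psi (t *: y + (1 - t) *: z))
          (rho (t *: y + (1 - t) *: z) (t * r + (1 - t) * s))) by exists t'.
  rewrite -!Tpt => k; rewrite -(TK k) !leT.
  have : above_lower_bounds (pt y r) (pt z s)
    (pt (t *: y + (1 - t) *: z) (t * r + (1 - t) * s)); last exact.
  by apply/(above_lower_bounds_pt _ _ _ _ _ _ yz); exists t.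
exists psi, sigma; split=> //.
- by apply: convex_combination_affine => x y t /(affE x y)[].
- by apply: convex_combination_affine => x y t /(affE x y)[].
move=> f x.
(* Both inequalities say that a function lies below a point function, and [T] exchanges them. Thus
   [T f (psi x)] and [f x + sigma x] have the same real upper bounds. *)
have TfP r : (T f (psi x) <= (r + sigma x)%:E)%E = (f x <= r%:E)%E.
  rewrite -rhoE; apply/idP/idP => [/le_pt|/le_pt fxr].
    by rewrite -Tpt leT => /le_pt.
  by apply/le_pt; rewrite -Tpt leT.
apply/le_anti/andP; split.
  case fx: (f x) => [r| |]; [|by rewrite addye// leey|].
    by rewrite -EFinD TfP fx.
  by have := (cvxfun_proper f).1 x; rewrite fx.
case Tfx: (T f (psi x)) => [r| |]; [|by rewrite leey|].
  by rewrite -leeBrDr// -EFinB -TfP subrK Tfx.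
by have := (cvxfun_proper (T f)).1 (psi x); rewrite Tfx.
Qed.

End Involution.

(** * Continuity from lower semicontinuity *)

Section Continuity.
Context {R : realType}.

Lemma near0_bounded_linear_continuous {X Y : normedModType R} (f : X -> Y) (M : R) :
  linear f -> (\forall v \near 0, `|f v| <= M) -> continuous f.
Proof.
move=> lf fM.
pose F : {linear X -> Y} := HB.pack f (GRing.isLinear.Build _ _ _ _ _ lf).
by apply: (@bounded_linear_continuous _ _ _ F); apply/ex_bound; exists M.
Qed.

(** Semicontinuity at 0 gives [f v > -1] on a ball; the symmetry of the ball turns this into
    [f v < 1] as well. *)
Lemma lsc_linear_continuous {X : normedModType R} (f : X -> R^o) (b : R) :
  linear f -> lower_semicontinuous (fun x => (f x + b : R)%:E) -> continuous f.
Proof.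
move=> lf lsc; apply: (near0_bounded_linear_continuous _ 1 lf).
have f0 : f 0 = 0 by have := lf (-1) 0 0; rewrite scaler0 add0r scaleN1r addNr.
have fN v : f (- v) = - f v by have := lf (-1) v 0; rewrite !addr0 f0 addr0 !scaleN1r.
have [|V /nbhs_norm0P[e /= e0 eV] fV] := lsc 0 (b - 1).
  by rewrite lte_fin f0; lra.
apply/nbhs_norm0P; exists e => //= v ve.
have := fV _ (eV _ ve); have /fV : V (- v) by apply: eV; rewrite /= normrN.
by rewrite !lte_fin fN ler_norml; lra.
Qed.

(** If [g] were unbounded above near every point, the open sets [O n] would all be dense. By
    completeness of [X] their intersection would be nonempty, yet no real number exceeds every
    natural number. *)
Lemma lsc_near_bounded {X : completeNormedModType R} (g : X -> R) :
  lower_semicontinuous (fun x => (g x)%:E) ->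
  exists x (M : R), \forall v \near 0, g (x + v) <= M.
Proof.
move=> /lower_semicontinuousP lsc.
pose O n := [set x | (n%:R%:E < (g x)%:E)%E].
apply: contrapT => unbounded.
have : dense (\bigcap_n O n).
  apply: Baire => n; split; first exact: lsc.
  move=> D [x Dx] oD; apply: contrapT => DO.
  apply: unbounded; exists x, n%:R; apply/(@nbhs0P _ _ (fun y => g y <= n%:R)).
  apply: filterS (open_nbhs_nbhs (conj oD Dx)) => y Dy.
  by rewrite leNgt; apply/negP => ngy; apply: DO; exists y; split.
move=> /(_ setT)[||x [_ /(_ (Num.truncn (g x)).+1 I)]].
- by exists 0.
- exact: openT.
by rewrite /O /= lte_fin ltNge ltW// truncnS_gt.
Qed.

Lemma clinear_of {X Y : normedModType R} (f : X -> Y) :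
  linear f -> continuous f -> exists u : clinear X Y, forall x, u x = f x.
Proof.
move=> lf cf; have fP : f \in @continuous_linear R X Y by apply/asboolP.
by exists (CLinear fP).
Qed.

End Continuity.

(** * The form of all order preserving involutions *)

Theorem corollary6 (R : realType) (X : completeNormedModType R)
    (X_nonzero : exists x : X, x != 0) (T : cvxfun X -> cvxfun X) :
  order_preserving_involution T <->
  exists (c : X) (w : dual X) (E : clinear X X),
    [/\ bijective E,
        E \o E = idfun,
        ker (E \+ idfun) c,
        ker (adjoint E \+ idfun) w &
        forall (f : cvxfun X) (x : X),
          T f x = (f (E x + c)%R + (pairing w x)%:E
                   - (2^-1 * pairing w c)%:E)%E].
Proof.
split=> [Topi|[c [w [E [_ EE Ec Ew TE]]]]]; last first.
  split=> [f g fg x|f]; first by rewrite !TE leeD2r// leeD2r.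
  apply: cvxfun_eq => x; rewrite !TE.
  have -> : E (E x + c) + c = x.
    rewrite linearD -addrA; have -> : E c + c = 0 by exact: Ec.
    by rewrite addr0; have := congr1 (@^~ x) EE.
  have Ewx : pairing w (E x) + pairing w x = 0.
    exact: (congr1 (fun u : dual X => pairing u x) Ew).
  have -> : pairing w (E x + c) = pairing w (E x) + pairing w c by exact: linearD.
  rewrite -!EFinN -!addeA -!EFinD.
  (* The additive terms of [T (T f)] cancel: [w] changes sign under [E], and the two halves of
     [pairing w c] absorb the one produced by the shift. *)
  have -> : pairing w (E x) + pairing w c + (- (2^-1 * pairing w c) +
    (pairing w x - 2^-1 * pairing w c)) = 0 by lra.
  by rewrite adde0.
have [psi [sigma [psiK lpsi lsigma TE]]] := involution_affine T Topi X_nonzero.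
(* Evaluating at [psi x] instead of [x] turns [TE] into a formula for [T f x], with additive term
   [h = sigma \o psi]. *)
pose c := psi 0; pose E x := psi x - c; pose h x := sigma (psi x).
have {}TE f x : T f x = (f (psi x) + (h x)%:E)%E by rewrite -{1}(psiK x) TE.
have psiE x : psi x = E x + c by rewrite /E subrK.
pose w x : R^o := h x - h 0.
have lw : linear w.
  have wE x : w x = sigma (E x) - sigma 0.
    have : sigma (E x + c) - sigma 0
        = sigma (E x) - sigma 0 + (sigma c - sigma 0).
      by have := lsigma 1 (E x) c; rewrite !scale1r.
    by rewrite -psiE /w /h -/c; lra.
  move=> a x y; rewrite !wE.
  have -> : E (a *: x + y) = a *: E x + E y := lpsi a x y.
  exact: lsigma.
(* Two test functions: [T zero] is [h], and [T nrm] is the norm of [psi] plus [h]; both are lower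
   semicontinuous. *)
have [||zero zeroE] := @cvxfun_of_real _ X (fun=> 0); first exact: cst_continuous.
  by move=> x y t _; rewrite !mulr0 addr0.
have [||nrm nrmE] := @cvxfun_of_real _ X Num.norm; first exact: norm_continuous.
  move=> x y t /andP[t0 t1]; apply: le_trans (ler_normD _ _) _.
  by rewrite !normrZ !gtr0_norm// subr_gt0.
have cw : continuous w.
  apply: (lsc_linear_continuous _ (h 0) lw).
  have := @cvxfun_lsc _ _ (T zero); congr lower_semicontinuous; apply/funext => x.
  by rewrite TE zeroE add0e /w subrK.
have cE : continuous E.
  have [|x0 [M ubM]] := lsc_near_bounded (fun x => `|psi x| + h x).
    have := @cvxfun_lsc _ _ (T nrm); congr lower_semicontinuous; apply/funext => x.
    by rewrite TE nrmE.
  have w1 : \forall v \near 0, `|w v| <= 1.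
    have w0 : w 0 = 0 by rewrite /w subrr.
    apply: cvgr_norm_le; [exact: cw|by rewrite w0 normr0].
  (* Near 0, [h (x0 + v) = h x0 + w v] is at least [h x0 - 1], so the norm of [psi (x0 + v)] is at
     most [M - h x0 + 1]; subtracting [psi x0] leaves the linear part at [v]. *)
  apply: (near0_bounded_linear_continuous _ (M - h x0 + 1 + `|psi x0|) lpsi).
  near=> v.
  have ubv : `|psi (x0 + v)| + h (x0 + v) <= M by near: v.
  have wv : `|w v| <= 1 by near: v.
  have wD : w (x0 + v) = w x0 + w v by have := lw 1 x0 v; rewrite !scale1r.
  have ED : E (x0 + v) = E x0 + E v by have := lpsi 1 x0 v; rewrite !scale1r.
  have -> : psi v - psi 0 = psi (x0 + v) - psi x0.
    by rewrite (psiE (x0 + v)) (psiE x0) ED [E x0 + E v]addrC -(addrA (E v)) addrK.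
  apply: le_trans (ler_normB _ _) _; rewrite lerD2r.
  by move: wD wv; rewrite /w ler_norml; lra.
have [Ec EcE] := clinear_of E lpsi cE; have [wc wcE] := clinear_of w lw cw.
have Ecc : Ec c + c = 0 by rewrite EcE -psiE /c psiK.
have EE x : Ec (Ec x) = x.
  by have := psiK x; rewrite !psiE -!EcE linearD -addrA Ecc addr0.
(* Applying [T] twice to the zero function isolates the additive term. At [x = 0] this gives
   [h 0 = - 2^-1 * w c], the constant of the formula; subtracting that case gives [w \o E = - w]. *)
have hh x : h (psi x) + h x = 0.
  have := congr1 (fun f : cvxfun X => f x) (Topi.2 zero).
  by rewrite !TE !zeroE add0e -EFinD => -[].
have wc2 : w c + 2 * h 0 = 0 by have := hh 0; rewrite /w -/c; lra.
have wE x : w (E x) + w x = 0.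
  have wD : w (E x + c) = w (E x) + w c.
    by have := lw 1 (E x) c; rewrite !scale1r.
  have := hh x; move: wD.
  by rewrite -psiE /w; move: wc2; rewrite /w; lra.
exists c, wc, Ec; split.
- by exists Ec => x; exact: EE.
- by apply/funext => x; exact: EE.
- exact: Ecc.
- by apply/val_inj/funext => x /=; rewrite -[RHS](wE x) -!wcE -EcE.
- move=> f x; rewrite TE EcE -psiE /pairing !wcE -addeA -EFinB.
  by congr (_ + _%:E)%E; move: wc2; rewrite /w; lra.
Unshelve. all: by end_near. Qed.
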